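(* Let $\alpha\in\mathfrak S_n$ be a quasi-diagram. Then the following statements are equivalent. (1) $g\cdot\alpha=g\alpha g^{-1}$ is regular for all $g\in D_n$. (2) $\alpha$ is rotatably regular. (3) Either $\alpha$ is maximal, or each orbit of $\zeta\alpha$ contains at least one isolated point of $\alpha$.
   Context: Permutations are composed from right to left and $\zeta=(1\,2\cdots n)\in\mathfrak S_n$. A quasi-diagram is a permutation $\alpha\in\mathfrak S_n$ with $\alpha^2=\mathrm{id}$; its isolated points are its fixed points. A quasi-diagram $\alpha$ is maximal if $\zeta\alpha$ has only one orbit on $\{1,\dots,n\}$. It is regular if every orbit of $\zeta\alpha$ on $\{1,\dots,n\}$ contains $1$ or at least one isolated point of $\alpha$ (equivalently, every orbit of $\alpha\zeta$ contains $n$ or at least one isolated point of $\alpha$). It is rotatably regular if $\zeta^l\alpha\zeta^{-l}$ is regular for every integer $l$. $D_n$ is the dihedral group (of order $2n$) of the $n$-gon with sides labeled $1,\dots,n$ consecutively around the boundary, viewed as the subgroup of $\mathfrak S_n$ generated by $\zeta$ and the reflection $\gamma$, $\gamma(i)=n+1-i$. *)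

(* Defs.v *)
From mathcomp Require Import all_boot all_order all_algebra all_fingroup.

Set Implicit Arguments.
Unset Strict Implicit.
Unset Printing Implicit Defensive.

Local Open Scope group_scope.

(** The label [k] of {1, ..., n} is the ordinal of value [k - 1] in ['I_n].
    MathComp composes permutations from left to right, [(s * t) i = t (s i)],
    so the right-to-left product "zeta alpha" is [alpha * zeta n] and the
    right-to-left conjugate "g alpha g^-1" is [g^-1 * alpha * g = alpha ^ g]. *)

Definition zeta (n : nat) : 'S_n := perm (@ordS_inj n).

(** On labels, [gamma] maps [k] to [n + 1 - k]. *)
Definition gamma (n : nat) : 'S_n := perm (@rev_ord_inj n).

Definition dihedral (n : nat) : {group 'S_n} := <<[set zeta n; gamma n]>>%G.

Definition expgz (gT : finGroupType) (x : gT) (l : int) : gT :=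
  match l with
  | Posz k => x ^+ k
  | Negz k => x ^- k.+1
  end.

Definition quasi_diagram (n : nat) (alpha : 'S_n) : Prop := alpha ^+ 2 = 1.

Definition isolated (n : nat) (alpha : 'S_n) : {set 'I_n} :=
  [set i | alpha i == i].

Definition zeta_orbits (n : nat) (alpha : 'S_n) : {set {set 'I_n}} :=
  porbits (alpha * zeta n).

Definition maximal_diagram (n : nat) (alpha : 'S_n) : Prop :=
  #|zeta_orbits alpha| = 1%N.

Definition regular (n : nat) (alpha : 'S_n) : Prop :=
  forall C : {set 'I_n}, C \in zeta_orbits alpha ->
    (exists2 i, i \in C & nat_of_ord i = 0%N)
    \/ (exists2 i, i \in C & i \in isolated alpha).

Definition rotatably_regular (n : nat) (alpha : 'S_n) : Prop :=
  forall l : int, regular (alpha ^ expgz (zeta n) l).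

(* Main.v *)
Require Import Defs.
From mathcomp Require Import all_boot all_order all_algebra all_fingroup.

Local Open Scope group_scope.

(** Conjugation by an element [g] of the dihedral group sends [zeta] to itself
    or to its inverse.  If [g] commutes with [zeta], conjugating [alpha] by [g]
    carries the orbits of the product of [alpha] and [zeta] over by [g]; if [g]
    inverts [zeta], the same holds with [g] preceded by [alpha], because [alpha]
    conjugates the inverse of that product into the product of [alpha] with the
    inverse of [zeta].  In both cases the transport map agrees with [g] on the
    isolated points ([porbit_dihedral]), so a single orbit stays a single orbit
    and orbits with isolated points stay such.  Hence being maximal, or having
    isolated points in all orbits, passes to every dihedral conjugate, and it
    implies regularity ([regular_dihedral]).

    Conversely, regularity of all rotations of [alpha] says that every orbit
    without isolated points contains all the preimages of the label 1 under the
    powers of [zeta].  As [zeta] is transitive ([zeta_transitive]), such an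
    orbit is everything, and [alpha] is maximal. *)

Lemma porbitJ (T : finType) (s t : {perm T}) (x : T) :
  porbit (s ^ t) (t x) = t @: porbit s x.
Proof.
apply/setP=> y; apply/porbitP/imsetP=> [[k ->]|[_ /porbitP[k ->] ->]].
  by exists ((s ^+ k) x); rewrite ?mem_porbit // -conjXg permJ.
by exists k; rewrite -conjXg permJ.
Qed.

Lemma zeta_expE (n : nat) (k : nat) (i : 'I_n) :
  (zeta n ^+ k) i = ((i + k) %% n)%N :> nat.
Proof.
elim: k => [|k IHk]; first by rewrite expg0 perm1 addn0 modn_small.
by rewrite expgSr permM permE /= IHk -addn1 modnDml addn1 addnS.
Qed.

Lemma zeta_transitive (n : nat) (i j : 'I_n) : exists k, (zeta n ^+ k) i = j.
Proof.
exists (n - i + j)%N; apply: val_inj; rewrite /= zeta_expE addnA.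
by rewrite subnKC 1?ltnW // modnDl modn_small.
Qed.

Lemma zetaJgamma (n : nat) : zeta n ^ gamma n = (zeta n)^-1.
Proof.
suff E : zeta n * gamma n * zeta n = gamma n.
  by apply: (mulIg (zeta n)); rewrite mulVg conjgE -mulgA E mulVg.
apply/permP=> i; apply: val_inj; rewrite !permM !permE /=.
have n_gt0 : 0 < n by apply: leq_ltn_trans (ltn_ord i).
have := ltn_ord i; rewrite leq_eqVlt => /predU1P[eq_i|lt_i].
  by rewrite eq_i modnn subn1 prednK // modnn subnn.
by rewrite (modn_small lt_i) subnSK // modn_small // ltn_subrL.
Qed.

(** Normalising the pair made of [zeta] and its inverse is a subgroup
    condition, so it need only be checked on the two generators. *)
Lemma zetaJ_dihedral (n : nat) (g : 'S_n) :
  g \in dihedral n -> zeta n ^ g = zeta n \/ zeta n ^ g = (zeta n)^-1.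
Proof.
pose Z := [set zeta n; (zeta n)^-1].
have sDN : dihedral n \subset 'N(Z).
  rewrite gen_subG; apply/subsetP=> h /set2P[]->; apply/normP;
    rewrite conjUg !conjg_set1.
    by rewrite conjVg /conjg mulKg.
  by rewrite conjVg zetaJgamma invgK setUC.
move=> /(subsetP sDN)/normP defZ; apply/set2P.
by rewrite -/Z -defZ memJ_conjg set21.
Qed.

(** Here [g] itself transports the orbits; [porbit_dihedral] covers reflections
    too, but only gives some transport map, and its value at the preimage of the
    label 1 is needed to recover maximality from regularity. *)
Lemma porbit_rotation {n : nat} (alpha : 'S_n) {g : 'S_n} (i : 'I_n) :
  zeta n ^ g = zeta n ->
  porbit (alpha ^ g * zeta n) (g i) = g @: porbit (alpha * zeta n) i.
Proof. by move=> zg; rewrite -porbitJ conjMg zg. Qed.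

Lemma porbit_dihedral {n : nat} {alpha g : 'S_n} :
    quasi_diagram alpha -> g \in dihedral n ->
  exists2 h : 'S_n, {in isolated alpha, h =1 g} &
    forall i, porbit (alpha ^ g * zeta n) (h i) = h @: porbit (alpha * zeta n) i.
Proof.
move=> alpha2 /zetaJ_dihedral[zg|zg].
  by exists g => // i; apply: porbit_rotation.
exists (alpha * g) => [i|i]; first by rewrite inE permM => /eqP->.
(* An orbit is also an orbit of the inverse permutation, and the inverse is
   what [alpha * g] conjugates into [alpha ^ g * zeta n]. *)
rewrite -porbitV -porbitJ porbitV -[in RHS]porbitV; congr (porbit _ _).
have E : (alpha * zeta n)^-1 ^ alpha = alpha * (zeta n)^-1.
  rewrite conjVg; apply: invg_inj; rewrite invgK conjgE -mulgA mulKg invMg invgK.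
  by congr (_ * _); apply: (mulgI alpha); rewrite mulgV.
by rewrite -conjVg conjgM E conjMg conjVg zg invgK.
Qed.

Lemma isolatedJ (n : nat) (alpha g : 'S_n) (i : 'I_n) :
  (g i \in isolated (alpha ^ g)) = (i \in isolated alpha).
Proof. by rewrite !inE permJ (inj_eq perm_inj). Qed.

Lemma porbit_maximal (n : nat) (alpha : 'S_n) (i j : 'I_n) :
  maximal_diagram alpha -> j \in porbit (alpha * zeta n) i.
Proof.
move=> /eqP/cards1P[C defC].
have orbC k : porbit (alpha * zeta n) k = C.
  by apply/set1P; rewrite -defC; apply: imset_f.
by rewrite orbC -(orbC j) porbit_id.
Qed.

Lemma regular_dihedral (n : nat) (alpha g : 'S_n) :
    quasi_diagram alpha -> g \in dihedral n ->
    maximal_diagram alpha \/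
      (forall C : {set 'I_n}, C \in zeta_orbits alpha ->
         exists2 i, i \in C & i \in isolated alpha) ->
  regular (alpha ^ g).
Proof.
move=> alpha2 Dg good C /imsetP[x _ ->].
have [h hg orbh] := porbit_dihedral alpha2 Dg.
rewrite -(permKV h x) orbh; case: good => [maxA|isoA].
  left; have n_gt0 : 0 < n by apply: leq_ltn_trans (ltn_ord x).
  exists (Ordinal n_gt0) => //.
  by rewrite -(permKV h (Ordinal n_gt0)) imset_f // porbit_maximal.
right; have /isoA[j Cj Ij] : porbit (alpha * zeta n) (h^-1 x) \in zeta_orbits alpha.
  exact: imset_f.
by exists (h j); [apply: imset_f | rewrite hg // isolatedJ].
Qed.

Lemma rotation_dihedral (n : nat) (l : int) : expgz (zeta n) l \in dihedral n.
Proof.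
have Dz : zeta n \in dihedral n by rewrite mem_gen // set21.
by case: l => k; rewrite /= ?groupV groupX.
Qed.

(** Rotating any label [j] to the label 1 shows that an orbit without isolated
    points contains [j]. *)
Lemma porbit_rotatably_regular (n : nat) (alpha : 'S_n) (i j : 'I_n) :
    rotatably_regular alpha ->
    ~~ [exists k in porbit (alpha * zeta n) i, k \in isolated alpha] ->
  j \in porbit (alpha * zeta n) i.
Proof.
move=> regA noiso; have n_gt0 : 0 < n by apply: leq_ltn_trans (ltn_ord i).
have [k kj] := zeta_transitive n j (Ordinal n_gt0).
set g := zeta n ^+ k in kj.
have zg : zeta n ^ g = zeta n by rewrite /g conjgE (commuteX k (commute_refl _)) mulKg.
have /(regA (Posz k)) : porbit (alpha ^ g * zeta n) (g i) \in zeta_orbits (alpha ^ g).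
  exact: imset_f.
rewrite (porbit_rotation alpha i zg) => -[[_ /imsetP[y Cy ->] gy0]|[_ /imsetP[y Cy ->]]].
  by rewrite -(_ : y = j) //; apply: (@perm_inj _ g); apply: val_inj; rewrite kj.
rewrite isolatedJ => Iy; case/existsP: noiso; by exists y; rewrite Cy.
Qed.

Lemma rotatably_regular_dichotomy (n : nat) (alpha : 'S_n) :
    rotatably_regular alpha ->
  maximal_diagram alpha \/
    (forall C : {set 'I_n}, C \in zeta_orbits alpha ->
       exists2 i, i \in C & i \in isolated alpha).
Proof.
move=> regA.
have [/forallP isoA|] := boolP [forall i, [exists k in porbit (alpha * zeta n) i,
  k \in isolated alpha]].
  right=> _ /imsetP[i _ ->]; have /existsP[k /andP[]] := isoA i; by exists k.
move=> /forallPn[i noiso]; left; apply/eqP/cards1P.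
exists (porbit (alpha * zeta n) i); apply/setP=> C; rewrite inE.
apply/imsetP/eqP=> [[j _ ->]|->]; last by exists i.
by apply/eqP; rewrite eq_porbit_mem porbit_rotatably_regular.
Qed.

Theorem theorem1p2 (n : nat) (alpha : 'S_n) (halpha : quasi_diagram alpha) :
  ((forall g : 'S_n, g \in dihedral n -> regular (alpha ^ g))
     <-> rotatably_regular alpha)
  /\ (rotatably_regular alpha
     <-> (maximal_diagram alpha
          \/ forall C : {set 'I_n}, C \in zeta_orbits alpha ->
               exists2 i, i \in C & i \in isolated alpha)).
Proof.
split; split.
- by move=> regD l; apply: regD; apply: rotation_dihedral.
- by move=> /rotatably_regular_dichotomy good g Dg; apply: regular_dihedral.
- exact: rotatably_regular_dichotomy.
- by move=> good l; apply: regular_dihedral (rotation_dihedral n l) good.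
Qed.
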